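(* Let $m\ge 1$ be an integer and let $V\subset\mathbb{P}^N$ be the Segre-Veronese variety $\mathbb{P}^1\times\mathbb{P}^m\times\mathbb{P}^m$ embedded with multi-degree $(2,1,1)$. Let $V^s$ be the $s$-th higher secant variety of $V$, that is, the closure of the union of all linear spaces spanned by $s$ independent points of $V$. If \[m+2\leq s\leq 2m+1,\] then $V$ is $s$-defective, i.e. $V^s$ does not have the expected dimension.
   Context: Work over $\mathbb{C}$. The embedding is the one given by the complete linear system of forms of multidegree $(2,1,1)$ on $\mathbb{P}^1\times\mathbb{P}^m\times\mathbb{P}^m$, so $N=3(m+1)^2-1$. The expected dimension of $V^s$ is the standard one, $\min\{N,\ s\dim V+s-1\}=\min\{N,\ s(2m+2)-1\}$. *)

(* Defs.v *)
From HB Require Import structures.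
From mathcomp Require Import all_boot all_order all_algebra.
From mathcomp Require Import boolp classical_sets reals.
From mathcomp Require Import complex mpoly.

Set Implicit Arguments.
Unset Strict Implicit.
Unset Printing Implicit Defensive.

Local Open Scope classical_set_scope.
Local Open Scope ring_scope.

Section ProjectiveGeometry.
Variables (K : fieldType) (n : nat).

(* The points of P^n are the lines through the origin of K^(n+1). *)
Definition proj_space : Type := {L : {vspace 'rV[K]_n.+1} | \dim L == 1%N}.

Definition vanishes_at (f : {mpoly K[n.+1]}) (p : proj_space) : Prop :=
  forall v : 'rV[K]_n.+1, v \in val p -> f.@[fun i => v 0 i] = 0.

Definition zariski_closed (X : set proj_space) : Prop :=
  exists S : set {mpoly K[n.+1]},
    (forall f, S f -> exists d : nat, f \is d.-homog) /\
    X = [set p | forall f, S f -> vanishes_at f p].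

Definition zariski_closure (X : set proj_space) : set proj_space :=
  [set p | forall Y, zariski_closed Y -> X `<=` Y -> Y p].

Definition zariski_irreducible (X : set proj_space) : Prop :=
  X !=set0 /\
  forall A B, zariski_closed A -> zariski_closed B ->
    X `<=` A `|` B -> X `<=` A \/ X `<=` B.

Definition irreducible_chain (X : set proj_space) (d : nat) : Prop :=
  exists Z : nat -> set proj_space,
    (forall i, (i <= d)%N ->
       [/\ zariski_closed (Z i), zariski_irreducible (Z i) & Z i `<=` X]) /\
    (forall i, (i < d)%N -> Z i `<` Z i.+1).

(* Krull dimension; meant for a closed X, whose closed subsets are the closed
   subsets of P^n contained in X. *)
Definition has_dim (X : set proj_space) (d : nat) : Prop :=
  irreducible_chain X d /\ forall e, irreducible_chain X e -> (e <= d)%N.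

Definition independent_points s (p : 'I_s -> proj_space) : Prop :=
  \dim (\sum_(i < s) val (p i))%VS = s.

Definition linear_span s (p : 'I_s -> proj_space) : set proj_space :=
  [set q | (val q <= \sum_(i < s) val (p i))%VS].

Definition secant_variety (s : nat) (X : set proj_space) : set proj_space :=
  zariski_closure
    [set q | exists p : 'I_s -> proj_space,
       [/\ forall i, X (p i), independent_points p & linear_span p q]].

Definition expected_dim (dimX s : nat) : nat := minn n (s * dimX + s - 1)%N.

(* The existential on d makes the claim contentful only for sets that do have
   a dimension, as every nonempty closed subset of P^n does. *)
Definition defective (dimX s : nat) (X : set proj_space) : Prop :=
  exists d, has_dim (secant_variety s X) d /\ d <> expected_dim dimX s.

End ProjectiveGeometry.

Section SegreVeronese211.
Variables (K : fieldType) (m : nat).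

(* (i, j, k) stands for the monomial x_0^(2-i) x_1^i y_j z_k; these form a basis
   of the forms of multidegree (2,1,1) on P^1 x P^m x P^m. *)
Definition sv_index : finType := ('I_3 * 'I_m.+1 * 'I_m.+1)%type.

Definition sv_N : nat := (3 * m.+1 ^ 2 - 1)%N.

Lemma card_sv_index : #|{: sv_index}| = sv_N.+1.
Proof.
by rewrite !card_prod !card_ord -mulnA mulnn /sv_N subn1 prednK ?muln_gt0 ?expn_gt0.
Qed.

Definition sv_monomial (x : 'rV[K]_2) (y z : 'rV[K]_m.+1) (t : sv_index) : K :=
  let: (i, j, k) := t in x 0 0 ^+ (2 - i) * x 0 1 ^+ i * y 0 j * z 0 k.

Definition sv_vector (x : 'rV[K]_2) (y z : 'rV[K]_m.+1) : 'rV[K]_sv_N.+1 :=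
  \row_l sv_monomial x y z (enum_val (cast_ord (esym card_sv_index) l)).

Definition segre_veronese : set (proj_space K sv_N) :=
  [set p | exists x y z,
     [/\ x != 0, y != 0, z != 0 & val p = <[sv_vector x y z]>%VS]].

End SegreVeronese211.

Arguments segre_veronese : clear implicits.

(* Main.v *)
(* Let n = m+1. A point of the cone over V^s is a triple of n x n matrices
   A_i = sum_p x_p0^(2-i) x_p1^i y_p z_p^T, and the block matrix [A_0 A_1; A_1 A_2]
   factors through an s-dimensional space. Hence, when A_0 is invertible, the
   Schur complement A_2 - A_1 A_0^-1 A_1 has rank at most t = s - n, so with
   B = A_0^-1 A_1 the triple is A_0 (1, B, B^2 + S) with rank S <= t. Projectively
   such triples depend on (n^2 - 1) + n^2 + (2nt - t^2) parameters, which is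
   2ns - 1 - t^2 = 3n^2 - 1 - (n-t)^2 and thus less than the expected dimension
   as 0 < t < n. A form that vanishes on the triples with A_0 invertible vanishes
   on the whole secant variety, since a line in the parameter space of the
   (x_p, y_p, z_p) through a point with A_0 = 1 meets that locus generically.

   The Krull dimension e of the closure of a union of finitely many images of
   polynomial maps in n variables is at most n by counting: separating forms f_i
   along a chain Z_0 < ... < Z_e, with a linear form l nonzero on Z_0, give k^e
   monomials l^(E - sum a_i d_i) prod f_i^(a_i) linearly independent on Z_e,
   whose pull-backs lie in spaces of dimension O(k^n). *)
Require Import Defs.
From mathcomp Require Import all_boot all_order all_algebra.
From mathcomp Require Import reals complex.
From mathcomp Require Import boolp classical_sets mpoly.
From mathcomp Require Import zify ring.

Set Implicit Arguments.
Unset Strict Implicit.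
Unset Printing Implicit Defensive.

Import Order.TTheory GRing.Theory Num.Theory.
Local Open Scope ring_scope.

(** * Krull dimension of parametrised closed sets *)

Section Points.
Variables (K : fieldType) (n : nat).
Implicit Types (f g : {mpoly K[n.+1]}) (p : proj_space K n) (Z : set (proj_space K n)).

Lemma proj_space_vline p : exists2 v, v != 0 & val p = <[v]>%VS.
Proof.
case: p => L dimL /=; exists (vpick L).
  by rewrite vpick0 -dimv_eq0 (eqP dimL).
apply/esym/eqP; rewrite eqEdim -memvE memv_pick (eqP dimL) dim_vline.
by rewrite vpick0 -dimv_eq0 (eqP dimL).
Qed.

Lemma meval_homogZ f d (c : K) (v : 'I_n.+1 -> K) :
  f \is d.-homog -> f.@[fun i => c * v i] = c ^+ d * f.@[v].
Proof.
move/dhomogP => hf; rewrite !mevalE mulr_sumr; apply: eq_big_seq => m /hf /= <-.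
rewrite mulrCA; congr (_ * _); rewrite /= mdegE -prodrXr -big_split /=.
by apply: eq_bigr => i _; rewrite exprMn.
Qed.

Lemma vanishes_at_vline f d p v : f \is d.-homog -> val p = <[v]>%VS ->
  f.@[fun i => v 0 i] = 0 -> vanishes_at f p.
Proof.
move=> hf pv f0 w; rewrite pv => /vlineP[c ->].
rewrite -[RHS](mulr0 (c ^+ d)) -f0 -meval_homogZ //.
by apply: meval_eq => i; rewrite mxE.
Qed.

Definition vanishes_on f Z := forall p, Z p -> vanishes_at f p.

Lemma vanishes_on_closed f d : f \is d.-homog ->
  zariski_closed [set p | vanishes_at f p]%classic.
Proof.
move=> hf; exists [set f]%classic; split; first by move=> _ ->; exists d.
by rewrite predeqE => p; split=> [fp _ ->|]; last exact.
Qed.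

Lemma vanishes_on_closure f d X : f \is d.-homog ->
  vanishes_on f X -> vanishes_on f (zariski_closure X).
Proof. by move=> hf fX p /(_ _ (vanishes_on_closed hf) fX). Qed.

(** The zero loci of [f] and [g] are closed because both are forms, and together they cover [Z];
    irreducibility puts [Z] inside one of them. *)
Lemma vanishes_onM f d g e Z : zariski_irreducible Z ->
  f \is d.-homog -> g \is e.-homog ->
  vanishes_on (f * g) Z -> vanishes_on f Z \/ vanishes_on g Z.
Proof.
move=> [_ irrZ] hf hg fgZ.
apply: irrZ (vanishes_on_closed hf) (vanishes_on_closed hg) _ => p Zp.
have [v v0 pv] := proj_space_vline p.
have /eqP : (f * g).@[fun i => v 0 i] = 0.
  by apply: fgZ Zp _ _; rewrite pv memv_line.
rewrite mevalM mulf_eq0 => /orP[] /eqP h.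
- by left; apply: vanishes_at_vline hf pv h.
- by right; apply: vanishes_at_vline hg pv h.
Qed.

(** If every form defining [Z] also vanished on [W], then [W] would lie in [Z]. *)
Lemma separating_form Z W : zariski_closed Z -> (Z `<` W)%classic ->
  exists f d, [/\ f \is d.-homog, vanishes_on f Z & ~ vanishes_on f W].
Proof.
move=> [S [hS ZE]] [_ nWZ]; apply: contrapT => none; apply: nWZ => p Wp.
rewrite ZE => f Sf; have [d hd] := hS f Sf.
apply: contrapT => nfp; apply: none; exists f, d; split => //.
  by rewrite ZE => q /(_ f Sf).
by move=> /(_ p Wp).
Qed.

Lemma nonvanishing_coordinate Z : (Z !=set0)%classic ->
  exists i, ~ vanishes_on 'X_i Z.
Proof.
move=> [p Zp]; have [v /rV0Pn[i vi] pv] := proj_space_vline p.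
exists i => /(_ _ Zp v); rewrite pv memv_line mevalXU => /(_ isT) /eqP.
by rewrite (negPf vi).
Qed.

End Points.

(** * Monomials in given forms, padded to a common degree *)

Fact leq_subr_of_leq_addr a b b' c : (b' <= b -> a + b <= c -> a <= c - b')%N.
Proof. lia. Qed.

(* Exponent vectors (a_(e-1), ..., a_0) with entries below k. *)
Fixpoint expvec (k e : nat) : finType :=
  if e is e'.+1 then ('I_k * expvec k e')%type : finType else unit.

Lemma card_expvec k e : #|expvec k e| = (k ^ e)%N.
Proof.
elim: e => [|e IH]; first by rewrite card_unit.
by rewrite /= card_prod card_ord IH expnS.
Qed.

(* l^(E - sum a_i d_i) * prod f_i^(a_i): of degree E when deg l = 1, deg f_i = d_i. *)
Fixpoint padded_monomial (A : comNzRingType) (k : nat) (l : A) (f : nat -> A)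
    (d : nat -> nat) (e E : nat) : expvec k e -> A :=
  match e return expvec k e -> A with
  | 0 => fun=> l ^+ E
  | e'.+1 => fun a => f e' ^+ a.1 * padded_monomial l f d (E - a.1 * d e') a.2
  end.

Lemma rmorph_padded_monomial (A B : comNzRingType) (phi : {rmorphism A -> B}) k l f d
    e E (a : expvec k e) :
  phi (padded_monomial l f d E a) = padded_monomial (phi l) (phi \o f) d E a.
Proof.
elim: e E a => [|e IH] E a /=; first by rewrite rmorphXn.
by rewrite rmorphM rmorphXn IH.
Qed.

(** The lower bound on [E] keeps every truncated subtraction in the exponent of [l] exact. *)
Lemma padded_monomial_homog (K : fieldType) n k (l : {mpoly K[n]}) f d e E
    (a : expvec k e) :
    l \is 1.-homog -> (forall i, (i < e)%N -> f i \is (d i).-homog) ->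
    (\sum_(i < e) k * d i <= E)%N ->
  padded_monomial l f d E a \is E.-homog.
Proof.
move=> hl; elim: e E a => [|e IH] E a /= hf.
  by move=> _; rewrite -{2}[E]mul1n dhomogMn.
rewrite big_ord_recr /= => hE; case: a => j a /=.
have jd : (j * d e <= k * d e)%N by rewrite leq_mul2r ltnW ?orbT.
rewrite -[X in X.-homog](subnKC (leq_trans jd (leq_trans (leq_addl _ _) hE))).
apply: dhomogM; first by rewrite mulnC dhomogMn // hf.
apply: IH => [i ie|]; first by apply: hf; lia.
exact: leq_subr_of_leq_addr jd hE.
Qed.

(** * Degree bounds and linear relations by counting coefficients *)

Definition deg_le (K : fieldType) n (p : {mpoly K[n]}) (D : nat) := (msize p <= D.+1)%N.

Lemma deg_leM (K : fieldType) n (p q : {mpoly K[n]}) D1 D2 :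
  deg_le p D1 -> deg_le q D2 -> deg_le (p * q) (D1 + D2).
Proof.
rewrite /deg_le; have [->|p0] := eqVneq p 0; first by rewrite mul0r msize0.
have [->|q0] := eqVneq q 0; first by rewrite mulr0 msize0.
by rewrite msizeM //; move: (msize p) (msize q) => a b; lia.
Qed.

Lemma deg_leX (K : fieldType) n (p : {mpoly K[n]}) D k :
  deg_le p D -> deg_le (p ^+ k) (k * D).
Proof.
move=> hp; elim: k => [|k IH]; first by rewrite expr0 /deg_le msize1.
by rewrite exprS mulSn; apply: deg_leM.
Qed.

(** A crude count of factors suffices: at most [E] copies of [l] and fewer than [k] of each [f i],
    all of degree at most [D]. *)
Lemma padded_monomial_deg (K : fieldType) n k (l : {mpoly K[n]}) f d D e E
    (a : expvec k e) :
    deg_le l D -> (forall i, (i < e)%N -> deg_le (f i) D) ->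
  deg_le (padded_monomial l f d E a) ((E + e * k) * D).
Proof.
move=> hl; elim: e E a => [|e IH] E a /= hf.
  by rewrite mul0n addn0; apply: deg_leX.
case: a => j a /=.
have h1 : deg_le (f e ^+ j) (j * D) by apply/deg_leX/hf.
have h2 : deg_le (padded_monomial l f d (E - j * d e) a) ((E - j * d e + e * k) * D).
  by apply: IH => i ie; apply: hf; lia.
have := deg_leM h1 h2; rewrite -mulnDl /deg_le => h.
apply: leq_trans h _; rewrite ltnS leq_mul2r; apply/orP; right.
have := ltn_ord j; lia.
Qed.

(** A matrix with more rows than columns has a nonzero left kernel. *)
Lemma linear_relation (K : fieldType) (A C : finType) (c : A -> C -> K) :
  (#|C| < #|A|)%N ->
  exists lam : A -> K, (exists a, lam a != 0) /\
    forall x, \sum_a lam a * c a x = 0.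
Proof.
move=> CA; pose M := \matrix_(i < #|A|, j < #|C|) c (enum_val i) (enum_val j).
have : kermx M != 0.
  rewrite kermx_eq0 /row_free neq_ltn; apply/orP; left.
  by apply: leq_ltn_trans CA; apply: rank_leq_col.
move=> /matrix0Pn[i [j kij]]; exists (fun a => kermx M i (enum_rank a)).
split; first by exists (enum_val j); rewrite enum_valK.
move=> x; have /matrixP/(_ i (enum_rank x)) := mulmx_ker M.
rewrite !mxE => Mi0; rewrite -[RHS]Mi0 (reindex (@enum_val A predT)) /=; last first.
  by apply: onW_bij; apply: enum_val_bij.
by apply: eq_bigr => a _; rewrite [M _ _]mxE enum_valK enum_rankK.
Qed.

Lemma card_bmultinom n D : (#|{: 'X_{1..n < D.+1}}| <= D.+1 ^ n)%N.
Proof.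
rewrite -[D.+1 in leqRHS]card_ord -[n in leqRHS]card_ord -card_ffun.
pose g (m : 'X_{1..n < D.+1}) : {ffun 'I_n -> 'I_D.+1} := [ffun i => inord (bmnm m i)].
suff /leq_card : injective g by [].
move=> m1 m2 /ffunP g12; apply/val_inj/mnmP => i.
have lt (m : 'X_{1..n < D.+1}) : (bmnm m i < D.+1)%N.
  apply: leq_ltn_trans (valP m).
  by rewrite /= mdegE (bigD1 i) //= leq_addr.
by have := g12 i; rewrite !ffunE => /(congr1 val); rewrite /= !inordK.
Qed.

(** The unknown [lam] solves one linear equation for each pair of an index [j] and a monomial of
    degree at most [D], so there are fewer equations than unknowns. *)
Lemma polynomial_relation (K : fieldType) (A J : finType) n D
    (P : A -> J -> {mpoly K[n]}) :
    (forall a j, deg_le (P a j) D) -> (#|J| * D.+1 ^ n < #|A|)%N ->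
  exists lam : A -> K, (exists a, lam a != 0) /\
    forall j, \sum_a lam a *: P a j = 0.
Proof.
move=> hP cA.
have [|lam [lam0 rel]] := @linear_relation K A (J * 'X_{1..n < D.+1})%type
    (fun a x => (P a x.1)@_(bmnm x.2)).
  by apply: leq_ltn_trans cA; rewrite card_prod leq_mul2l card_bmultinom orbT.
exists lam; split => // j; apply/mpolyP => m; rewrite mcoeff0 raddf_sum /=.
under eq_bigr do rewrite mcoeffZ.
have [mD|mD] := ltnP (mdeg m) D.+1; first exact: (rel (j, BMultinom mD)).
apply: big1 => a _; rewrite memN_msupp_eq0 ?mulr0 //; apply: msize_mdeg_ge.
exact: leq_trans (hP a j) mD.
Qed.

(** * Length of chains of irreducible closed sets *)

Section ChainBound.
Variables (K : fieldType) (N : nat).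

(** On [Z] only the term [G 0] survives, so it is zero. What remains is a multiple of [f], which can
    be cancelled on the irreducible [W], and induction on [k] applies to the shifted series. *)
Lemma vanishing_series_coefficients (Z W : set (proj_space K N))
    (f : {mpoly K[N.+1]}) d k E
    (G : nat -> {mpoly K[N.+1]}) :
    zariski_irreducible W -> (Z `<=` W)%classic -> f \is d.-homog ->
    vanishes_on f Z -> ~ vanishes_on f W -> (k * d <= E)%N ->
    (forall j, (j < k)%N -> G j \is (E - j * d).-homog) ->
    (forall j, (j < k)%N -> vanishes_on (G j) Z -> G j = 0) ->
    vanishes_on (\sum_(j < k) f ^+ j * G j) W ->
  forall j, (j < k)%N -> G j = 0.
Proof.
move=> irrW ZW hf fZ fW; elim: k E G => [//|k IH] E G kE hG GZ sW.
have sE : \sum_(j < k.+1) f ^+ j * G j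
    = G 0%N + f * \sum_(j < k) f ^+ j * G j.+1.
  rewrite big_ord_recl expr0 mul1r mulr_sumr; congr (_ + _).
  by apply: eq_bigr => j _; rewrite /= /bump /= add1n exprS mulrA.
have G0 : G 0%N = 0.
  apply: GZ => // p Zp v pv; have := sW p (ZW p Zp) v pv.
  by rewrite sE mevalD mevalM (fZ p Zp v pv) mul0r addr0.
move: sW; rewrite sE G0 add0r => /(vanishes_onM irrW hf).
have hS : \sum_(j < k) f ^+ j * G j.+1 \is (E - d).-homog.
  apply: rpred_sum => j _; have jk := ltn_ord j.
  have -> : (E - d = d * j + (E - j.+1 * d))%N.
    have : (j.+1 * d <= k.+1 * d)%N by rewrite leq_mul2r; lia.
    lia.
  by apply: dhomogM; [apply: dhomogMn|apply: hG].
move=> /(_ _ hS) [//|sW] [//|j] jk.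
apply: (IH (E - d)%N (fun j => G j.+1)) => //; first lia.
- by move=> i ik; rewrite -subnDA -mulSn; apply: hG.
- by move=> i ik; apply: GZ.
Qed.

(** Induction along the chain: sorting by the exponent of the last form gives a series in [f e]
    whose coefficients are combinations of shorter padded monomials, free on [Z e] by induction. *)
Lemma padded_monomials_free (Z : nat -> set (proj_space K N))
    (l : {mpoly K[N.+1]}) f d k e E
    (lam : expvec k e -> K) :
    (forall i, (i <= e)%N -> zariski_irreducible (Z i)) ->
    (forall i, (i < e)%N -> (Z i `<=` Z i.+1)%classic) ->
    l \is 1.-homog -> ~ vanishes_on l (Z 0%N) ->
    (forall i, (i < e)%N -> [/\ f i \is (d i).-homog, vanishes_on (f i) (Z i)
                              & ~ vanishes_on (f i) (Z i.+1)]) ->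
    (\sum_(i < e) k * d i <= E)%N ->
    vanishes_on (\sum_a lam a *: padded_monomial l f d E a) (Z e) ->
  forall a, lam a = 0.
Proof.
elim: e E lam => [|e IH] E lam irrZ ZZ hl lZ0 hf.
  move=> _ /= van []; apply/eqP/negP => /negP lam0.
  have lXZ : vanishes_on (l ^+ E) (Z 0%N).
    move=> p Zp v pv; have := van p Zp v pv.
    rewrite (bigD1 tt) // big1 /=; last by case.
    by rewrite addr0 mevalZ => /eqP; rewrite mulf_eq0 (negPf lam0) => /eqP.
  (* A power of [l] cannot vanish on [Z 0]: factors are cancelled one at a time, down to the
     constant 1, which is evaluated at the zero vector. *)
  elim: E lXZ {van} => [|E IHE].
    move=> h; have [[p Zp] _] := irrZ 0%N isT.
    have /eqP := h p Zp 0 (mem0v _); rewrite expr0 meval1.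
    by rewrite oner_eq0.
  have hE : l ^+ E \is E.-homog by rewrite -{2}[E]mul1n dhomogMn.
  by rewrite exprS => /(vanishes_onM (irrZ 0%N isT) hl hE)[].
rewrite big_ord_recr /= => hE van.
have [hfe feZ feZ'] := hf e (ltnSn e).
have hf' i : (i < e)%N -> f i \is (d i).-homog.
  by move=> ie; have [] := hf i (ltnW ie).
have jd (j : 'I_k) : (j * d e <= k * d e)%N by rewrite leq_mul2r ltnW ?orbT.
(* The coefficient of [f e ^+ j], extended by 0 to [j >= k]. *)
pose G j := if insub j is Some j' then
   \sum_a lam (j', a) *: padded_monomial l f d (E - j * d e) a else 0.
have GE (j : 'I_k) : G j = \sum_a lam (j, a) *: padded_monomial l f d (E - j * d e) a.
  by rewrite /G valK.
have homG j : (j < k)%N -> G j \is (E - j * d e).-homog.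
  move=> jk; rewrite (GE (Ordinal jk)); apply: rpred_sum => a _ /=.
  apply: dhomogZ; apply: padded_monomial_homog => //.
  exact: leq_subr_of_leq_addr (jd (Ordinal jk)) hE.
have lamZ (j : 'I_k) : vanishes_on (G j) (Z e) -> forall a, lam (j, a) = 0.
  rewrite GE; apply: IH => //.
  - by move=> i ie; apply: irrZ; lia.
  - by move=> i ie; apply: ZZ; lia.
  - by move=> i ie; apply: hf; lia.
  - exact: leq_subr_of_leq_addr (jd j) hE.
have G0 : forall j, (j < k)%N -> G j = 0.
  apply: (@vanishing_series_coefficients (Z e) (Z e.+1) (f e) (d e) k E) => //.
  - exact: irrZ.
  - exact: ZZ.
  - exact: leq_trans (leq_addl _ _) hE.
  - move=> j jk /(lamZ (Ordinal jk)) h; rewrite (GE (Ordinal jk)).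
    by apply: big1 => a _; rewrite h scale0r.
  - suff -> : \sum_(j < k) f e ^+ j * G j = \sum_a lam a *:
        (f e ^+ a.1 * padded_monomial l f d (E - a.1 * d e) a.2) by [].
    under eq_bigr do rewrite GE mulr_sumr.
    rewrite pair_bigA /=; apply: eq_bigr => -[j a] _ /=.
    by rewrite scalerAr.
case=> j a; apply: lamZ; rewrite G0 // => p _ v _; exact: meval0.
Qed.

(** The first hypothesis expresses that [X] lies in the closure of the union of the images of the
    maps [Phi j]. If [e > n], some combination of padded monomials pulls back to 0 under all of
    them, hence vanishes on [Z e], against freeness. *)
Lemma chain_length_le (J : finType) n (X : set (proj_space K N))
    (Phi : J -> N.+1.-tuple {mpoly K[n]}) e :
    (forall F E, F \is E.-homog -> (forall j, F \mPo Phi j = 0) -> vanishes_on F X) ->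
    irreducible_chain (zariski_closure X) e -> (e <= n)%N.
Proof.
move=> dense [Z [hZ ZZ]]; rewrite leqNgt; apply/negP => ne.
have sep i : exists fd : {mpoly K[N.+1]} * nat, (i < e)%N ->
    [/\ fd.1 \is (fd.2).-homog, vanishes_on fd.1 (Z i) & ~ vanishes_on fd.1 (Z i.+1)].
  have [ie|ie] := ltnP i e; last by exists (0, 0%N).
  have [clZ _ _] := hZ i (ltnW ie).
  by have [g [d ?]] := separating_form clZ (ZZ i ie); exists (g, d).
have {sep}[fd hfd] := choice sep.
pose f i := (fd i).1; pose d i := (fd i).2.
have [_ [Z0n _] _] := hZ 0%N isT.
have [c lZ0] := nonvanishing_coordinate Z0n.
pose l : {mpoly K[N.+1]} := 'X_c.
have hl : l \is 1.-homog by rewrite dhomogX; apply/eqP/mdeg1.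
pose D := (\max_(j : J) (msize (l \mPo Phi j) + \max_(i < e) msize (f i \mPo Phi j)))%N.
have degl j : deg_le (l \mPo Phi j) D.
  rewrite /deg_le ltnW // ltnS; apply: leq_trans (leq_bigmax j).
  exact: leq_addr.
have degf j i : (i < e)%N -> deg_le (f i \mPo Phi j) D.
  move=> ie; rewrite /deg_le ltnW // ltnS; apply: leq_trans (leq_bigmax j).
  apply: leq_trans (leq_addl _ _).
  exact: (leq_bigmax (F := fun i : 'I_e => msize (f i \mPo Phi j)) (Ordinal ie)).
(* Pulled-back monomials have degree at most [(E + e * k) * D = k * C]. As [k * C + 1 <= k * C.+1],
   the choice of [k] makes [k ^ n.+1] exceed [#|J| * (k * C).+1 ^ n]. *)
pose C := (((\sum_(i < e) d i) + e) * D)%N.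
pose k := (#|J| * C.+1 ^ n).+1.
pose E := (\sum_(i < e) k * d i)%N.
pose P (a : expvec k e) j := padded_monomial l f d E a \mPo Phi j.
have degP a j : deg_le (P a j) (k * C).
  rewrite /P (rmorph_padded_monomial (comp_mpoly (Phi j))).
  have -> : (k * C = (E + e * k) * D)%N by rewrite /C /E -big_distrr /=; lia.
  by apply: padded_monomial_deg => [|i ie]; [apply: degl|apply: degf].
have [|lam [[a lama] rel]] := polynomial_relation degP.
  rewrite card_expvec; apply: (@leq_trans (k ^ n.+1)); last by rewrite leq_pexp2l.
  apply: (@leq_ltn_trans (#|J| * (k * C.+1) ^ n)).
    have kC : ((k * C).+1 <= k * C.+1)%N.
      by rewrite mulnS -[(k * C).+1]add1n leq_add2r.
    have [->|n0] := posnP n; first by rewrite !expn0.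
    by rewrite leq_mul2l leq_exp2r // kC orbT.
  by rewrite expnMn mulnCA expnSr ltn_pmul2l ?expn_gt0.
have hG : \sum_a lam a *: padded_monomial l f d E a \is E.-homog.
  apply: rpred_sum => b _; apply: dhomogZ; apply: padded_monomial_homog => //.
  by move=> i /hfd[].
move/eqP: lama; apply.
apply: (@padded_monomials_free Z l f d k e E lam) => //.
- by move=> i /hZ[].
- by move=> i /ZZ[].
have [_ _ ZX] := hZ e (leqnn e).
suff GX : vanishes_on (\sum_a lam a *: padded_monomial l f d E a) X.
  by move=> p /ZX; apply: vanishes_on_closure hG GX p.
apply: dense hG _ => j; rewrite -[RHS](rel j) raddf_sum.
by apply: eq_bigr => b _; apply: comp_mpolyZ.
Qed.

End ChainBound.

(** * Existence of the dimension under a bound on chains *)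

Section Dimension.
Variables (K : fieldType) (n : nat).

(** The point is cut out by the 2 x 2 minors against [v] that involve a nonzero coordinate
    [v 0 i]. *)
Lemma proj_point_closed (p : proj_space K n) : zariski_closed [set p]%classic.
Proof.
have [v /rV0Pn[i vi] pv] := proj_space_vline p.
pose f j : {mpoly K[n.+1]} := v 0 i *: 'X_j - v 0 j *: 'X_i.
have fE j (w : 'rV_n.+1) : (f j).@[fun c => w 0 c] = v 0 i * w 0 j - v 0 j * w 0 i.
  by rewrite mevalB !mevalZ !mevalXU.
have hf j : f j \is 1.-homog.
  by apply: rpredB; apply: dhomogZ; rewrite dhomogX; apply/eqP/mdeg1.
exists [set g | exists j, g = f j]%classic; split.
  by move=> _ [j ->]; exists 1%N.
rewrite predeqE => q; split=> [-> _ [j ->]|fq].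
  by apply: vanishes_at_vline (hf j) pv _; rewrite fE mulrC subrr.
apply/val_inj; rewrite /= pv; apply/eqP.
rewrite eqEdim (eqP (valP q)) dim_vline.
have [w w0 qw] := proj_space_vline q.
have v0 : v != 0 by apply: contraNneq vi => ->; rewrite mxE.
rewrite v0 leqnn andbT qw -memvE; apply/vlineP; exists (w 0 i / v 0 i).
apply/rowP => j; rewrite mxE.
have /eqP : v 0 i * w 0 j - v 0 j * w 0 i = 0.
  by rewrite -fE; apply: (fq _ (ex_intro _ j erefl)); rewrite qw memv_line.
rewrite subr_eq0 => /eqP wv; apply: (mulfI vi).
by rewrite wv mulrA [_ * (_ / _)]mulrC divfK // mulrC.
Qed.

Lemma proj_point_irreducible (p : proj_space K n) :
  zariski_irreducible [set p]%classic.
Proof.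
split; first by exists p.
by move=> A B _ _ /(_ p erefl)[?|?]; [left|right] => _ ->.
Qed.

(** A single point is a chain of length 0, so the chain lengths form a nonempty bounded set, which
    has a maximum. *)
Lemma has_dim_of_chain_bound (X : set (proj_space K n)) d :
    (X !=set0)%classic -> (forall e, irreducible_chain X e -> (e <= d)%N) ->
  exists2 e, has_dim X e & (e <= d)%N.
Proof.
move=> [p Xp] bnd; pose P e := `[< irreducible_chain X e >].
have exP : exists e, P e.
  exists 0%N; apply/asboolP; exists (fun=> [set p]%classic); split => // i _.
  by split=> [||q ->] //; [apply: proj_point_closed|apply: proj_point_irreducible].
have bndP e : P e -> (e <= d)%N by move/asboolP; apply: bnd.
case: (ex_maxnP exP bndP) => e Pe maxe; exists e; last exact: bndP.
by split=> [|e' /asboolP]; [apply/asboolP|apply: maxe].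
Qed.

End Dimension.

(** * Density and Schur complements *)

Section PolynomialFunctions.
Variable K : numFieldType.
Implicit Types (g h : K -> K) (u : K).

Definition polyfun g := exists p : {poly K}, forall u, g u = p.[u].

Lemma polyfun_cst c : polyfun (fun=> c).
Proof. by exists c%:P => u; rewrite hornerC. Qed.

Lemma polyfun_id : polyfun id.
Proof. by exists 'X => u; rewrite hornerX. Qed.

Lemma polyfunD g h : polyfun g -> polyfun h -> polyfun (fun u => g u + h u).
Proof. by move=> [p gp] [q hq]; exists (p + q) => u; rewrite hornerD gp hq. Qed.

Lemma polyfunM g h : polyfun g -> polyfun h -> polyfun (fun u => g u * h u).
Proof. by move=> [p gp] [q hq]; exists (p * q) => u; rewrite hornerM gp hq. Qed.

Lemma polyfunX g k : polyfun g -> polyfun (fun u => g u ^+ k).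
Proof. by move=> [p gp]; exists (p ^+ k) => u; rewrite horner_exp gp. Qed.

Lemma polyfun_sum (I : Type) (r : seq I) (g : I -> K -> K) :
  (forall i, polyfun (g i)) -> polyfun (fun u => \sum_(i <- r) g i u).
Proof.
move=> /choice[p gp]; exists (\sum_(i <- r) p i) => u.
by rewrite horner_sum; apply: eq_bigr => i _.
Qed.

Lemma polyfun_prod (I : Type) (r : seq I) (g : I -> K -> K) :
  (forall i, polyfun (g i)) -> polyfun (fun u => \prod_(i <- r) g i u).
Proof.
move=> /choice[p gp]; exists (\prod_(i <- r) p i) => u.
by rewrite horner_prod; apply: eq_bigr => i _.
Qed.

Lemma polyfun_det n (A : K -> 'M[K]_n) :
  (forall i j, polyfun (fun u => A u i j)) -> polyfun (fun u => \det (A u)).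
Proof.
move=> hA; apply: polyfun_sum => s; apply: polyfunM; first exact: polyfun_cst.
by apply: polyfun_prod.
Qed.

Lemma polyfun_meval n (F : {mpoly K[n]}) (v : K -> 'I_n -> K) :
  (forall i, polyfun (v^~ i)) -> polyfun (fun u => F.@[v u]).
Proof.
move=> hv; have [|p pE] := @polyfun_sum _ (msupp F)
    (fun m u => F@_m * \prod_i v u i ^+ m i).
  move=> m; apply: polyfunM; first exact: polyfun_cst.
  by apply: polyfun_prod => i; apply: polyfunX.
by exists p => u; rewrite mevalE pE.
Qed.

(** The product of the two polynomials vanishes at all natural numbers, which are distinct in
    characteristic 0, so it is zero, while the factor of [h] is not. *)
Lemma polyfun_density g h u0 : polyfun g -> polyfun h -> h u0 != 0 ->
  (forall u, h u != 0 -> g u = 0) -> forall u, g u = 0.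
Proof.
move=> [p gp] [q hq] hu0 gh u.
have /eqP : p * q = 0.
  apply: contraTeq isT => pq0.
  have /= := @max_poly_roots _ (p * q) [seq i%:R | i <- iota 0 (size (p * q))] pq0.
  rewrite size_map size_iota ltnn => -> //; last first.
    by rewrite map_inj_uniq ?iota_uniq // => i j /eqP; rewrite eqr_nat => /eqP.
  apply/allP => x _; rewrite rootM /root -gp -hq.
  by have [_|/gh ->] := eqVneq (h x) 0; rewrite ?eqxx ?orbT.
rewrite mulf_eq0 => /orP[] /eqP z; first by rewrite gp z horner0.
by move: hu0; rewrite hq z horner0 eqxx.
Qed.

End PolynomialFunctions.

(** * Schur complements and parametrisation of matrices of bounded rank *)

Lemma rank_schur_complement (F : fieldType) n s (U0 U1 : 'M[F]_(n, s)) (W0 W1 : 'M_(s, n)) :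
  U0 *m W0 \in unitmx ->
  (\rank (U1 *m W1 - U1 *m W0 *m invmx (U0 *m W0) *m (U0 *m W1))%R <= s - n)%N.
Proof.
set A := U0 *m W0 => Au.
(* The Schur complement is [U1 *m E *m W1], and [E] kills [W0], which has rank [n]; hence [E] has
   rank at most [s - n]. *)
pose E := 1%:M - W0 *m invmx A *m U0.
have -> : U1 *m W1 - U1 *m W0 *m invmx A *m (U0 *m W1) = U1 *m (E *m W1).
  by rewrite mulmxBl mul1mx mulmxBr !mulmxA.
apply: leq_trans (mxrankM_maxr _ _) _; apply: leq_trans (mxrankM_maxl _ _) _.
have EW0 : E *m W0 = 0.
  by rewrite mulmxBl mul1mx -!mulmxA mulVmx // mulmx1 subrr.
have := mulmx0_rank_max EW0.
have : (n <= \rank W0)%N by rewrite -{1}(mxrank_unit Au) mxrankM_maxr.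
lia.
Qed.

(** For fixed [sigma], a polynomial family in [t * p + r * t] parameters: rows marked [inl] are rows
    of [S1], the others are combinations of these. The finitely many [sigma] together reach every
    matrix of rank at most [t] when [n = t + r]. *)
Definition row_pattern (R : pzRingType) n t r p (sigma : {ffun 'I_n -> 'I_t + 'I_r})
    (S1 : 'M[R]_(t, p)) (W : 'M[R]_(r, t)) : 'M_(n, p) :=
  \matrix_(i, j) match sigma i with inl a => S1 a j | inr b => (W *m S1) b j end.

Lemma rank_row_pattern (F : fieldType) n t r p (A : 'M[F]_(n.+1, p)) :
    (n.+1 = t + r)%N -> (\rank A <= t)%N ->
  exists (sigma : {ffun 'I_n.+1 -> 'I_t + 'I_r}) S1 W, A = row_pattern sigma S1 W.
Proof.
move=> ntr rkA; set f := maxrankfun A.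
pose B := [set f i | i in [set: 'I_(\rank A)]]%SET.
(* Rows of a maximal independent family come first; as the rank is at most [t], the first [t] rows
   in this order span the row space. *)
pose L := enum B ++ enum (~: B)%SET.
have memL i : i \in L by rewrite mem_cat !mem_enum finset.in_setC orbN.
have uniqL : uniq L.
  rewrite cat_uniq !enum_uniq /= andbT; apply/hasPn => i.
  by rewrite !mem_enum finset.in_setC.
have sizeL : size L = n.+1.
  by rewrite -(card_uniqP uniqL) (eq_card (B := predT)) ?card_ord // => i; rewrite memL.
have idxL i : (index i L < n.+1)%N by move: (memL i); rewrite -index_mem sizeL.
pose sigma := [ffun i => split (cast_ord ntr (Ordinal (idxL i)))].
pose S1 : 'M_(t, p) := \matrix_(a, j) A (nth ord0 L a) j.
have AS1 : (A <= S1)%MS.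
  rewrite -(eq_maxrowsub A); apply/row_subP => c.
  have ct : (index (f c) L < t)%N.
    rewrite index_cat mem_enum finset.imset_f //; apply: leq_trans rkA.
    rewrite -[X in (_ < X)%N]card_ord -finset.cardsT -(finset.card_imset _ (maxrankfun_inj (A := A))) cardE.
    by rewrite index_mem mem_enum finset.imset_f.
  rewrite (_ : row c _ = row (Ordinal ct) S1) ?row_sub //.
  by apply/rowP => j; rewrite !mxE /= nth_index.
have [D AD] := submxP AS1.
exists sigma, S1, (\matrix_(b, a) D (nth ord0 L (t + b)) a).
apply/matrixP => i j; rewrite mxE ffunE; case: split_ordP => [a|b] ia.
  by rewrite mxE -[a : nat]/(lshift r a : nat) -ia /= nth_index.
rewrite {1}AD !mxE; apply: eq_bigr => a _; rewrite !mxE; congr (D _ _ * _).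
  by rewrite -[(t + b)%N]/(rshift t b : nat) -ia /= nth_index.
Qed.

(** * Secant varieties of P^1 x P^m x P^m in degree (2,1,1) *)

Lemma ord2P (c : 'I_2) : c = 0 \/ c = 1.
Proof. by case: c => [[|[|c]] lt] //; [left|right]; apply/val_inj. Qed.

(** * Points of the secant cone as triples of square matrices *)

Section Slices.
Variable m : nat.
Notation n := m.+1.

Definition slice_entry (T : Type) (A : 'I_3 -> 'M[T]_n) (l : 'I_(sv_N m).+1) : T :=
  let: (i, j, k) := enum_val (cast_ord (esym (card_sv_index m)) l) in A i j k.

Lemma slice_entry_map (T U : Type) (phi : T -> U) (A : 'I_3 -> 'M[T]_n) l :
  phi (slice_entry A l) = slice_entry (fun i => map_mx phi (A i)) l.
Proof. by rewrite /slice_entry; case: enum_val => [[i j] k]; rewrite mxE. Qed.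

Lemma eq_slice_entry (T : Type) (A B : 'I_3 -> 'M[T]_n) :
  A =1 B -> slice_entry A =1 slice_entry B.
Proof. by move=> AB l; rewrite /slice_entry; case: enum_val => [[i j] k]; rewrite AB. Qed.

Definition power_slices (K : fieldType) s (X : 'M[K]_(s, 2)) (Y Z : 'M[K]_(s, n))
    (i : 'I_3) : 'M[K]_n :=
  \matrix_(j, k) \sum_(p < s) X p 0 ^+ (2 - i) * X p 1 ^+ i * Y p j * Z p k.

Lemma sum_sv_vector (K : fieldType) s (X : 'M[K]_(s, 2)) (Y Z : 'M[K]_(s, n)) :
  \sum_(p < s) sv_vector (row p X) (row p Y) (row p Z)
    = \row_l slice_entry (power_slices X Y Z) l.
Proof.
apply/rowP => l; rewrite summxE mxE /slice_entry.
under eq_bigr do rewrite mxE.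
by case: enum_val => [[i j] k]; rewrite mxE; apply: eq_bigr => p _; rewrite /= !mxE.
Qed.

(** The monomial of index [i] splits as [X p c * X p c']. The middle slice splits in two ways, which
    yields the factored block matrix needed for the Schur complement. *)
Lemma power_slicesE (K : fieldType) s (X : 'M[K]_(s, 2)) (Y Z : 'M[K]_(s, n))
    (i : 'I_3) (c c' : 'I_2) :
  i = (c + c')%N :> nat ->
  power_slices X Y Z i =
    (\matrix_(j, p) (Y p j * X p c)) *m (\matrix_(p, k) (X p c' * Z p k)).
Proof.
move=> icc; apply/matrixP => j k; rewrite !mxE; apply: eq_bigr => p _; rewrite !mxE icc.
case: (ord2P c) => ->; case: (ord2P c') => -> /=; rewrite ?(addn0, add0n, modn_small, subn0, subnn) //= ?(expr0, expr1, expr2); ring.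
Qed.

(* The coordinates of the family of slices A (1, B, B^2 + S), with one entry of
   A (the one with index q) equal to 1 and S of rank <= t. *)
Definition nf_param (t r : nat) : finType :=
  ('I_(#|{: 'I_n * 'I_n}|.-1) + 'I_n * 'I_n + 'I_t * 'I_n + 'I_r * 'I_t)%type.

(** * The normal form and its polynomial parametrisation *)

Section NormalForm.
Variables (R : comNzRingType) (t r : nat) (q : 'I_#|{: 'I_n * 'I_n}|).
Variable sigma : {ffun 'I_n -> 'I_t + 'I_r}.

Definition nf_lead (w : nf_param t r -> R) : 'M[R]_n :=
  \matrix_(j, k) if unlift q (enum_rank (j, k)) is Some l then w (inl (inl (inl l))) else 1.
Definition nf_mid (w : nf_param t r -> R) : 'M[R]_n :=
  \matrix_(j, k) w (inl (inl (inr (j, k)))).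
Definition nf_low (w : nf_param t r -> R) : 'M[R]_n :=
  row_pattern sigma (\matrix_(j, k) w (inl (inr (j, k)))) (\matrix_(j, k) w (inr (j, k))).

Definition nf_slices w (i : 'I_3) : 'M[R]_n :=
  nf_lead w * (nf_mid w ^+ i + nf_low w *+ (i == 2 :> nat)).

Lemma nf_slices_surj (A B S : 'M[R]_n) S1 W :
    A (enum_val q).1 (enum_val q).2 = 1 -> S = row_pattern sigma S1 W ->
  exists w, forall i, nf_slices w i = A * (B ^+ i + S *+ (i == 2 :> nat)).
Proof.
move=> Aq ->.
exists (fun c => match c with
  | inl (inl (inl l)) => let jk := enum_val (lift q l) in A jk.1 jk.2
  | inl (inl (inr (j, k))) => B j k
  | inl (inr (a, k)) => S1 a k
  | inr (b, a) => W b a end) => i.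
rewrite /nf_slices; congr (_ * (_ ^+ i + _ *+ _)).
- apply/matrixP => j k; rewrite mxE; case: unliftP => [l jk|jk].
    by rewrite -jk enum_rankK.
  by rewrite -Aq -jk enum_rankK.
- by apply/matrixP => j k; rewrite mxE.
- by rewrite /nf_low; congr row_pattern; apply/matrixP => j k; rewrite mxE.
Qed.

End NormalForm.

Lemma map_nf_slices (R R' : comNzRingType) (phi : {rmorphism R -> R'}) t r q
    (sigma : {ffun 'I_n -> 'I_t + 'I_r}) w i :
  map_mx phi (nf_slices q sigma w i) = nf_slices q sigma (phi \o w) i.
Proof.
rewrite /nf_slices map_mxM map_mxD rmorphXn rmorphMn.
congr (_ * (_ ^+ i + _ *+ _)); apply/matrixP => j k; rewrite !mxE //=.
  by case: unlift => [l|] //; rewrite rmorph1.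
case: (sigma j) => [a|b]; rewrite !mxE // rmorph_sum; apply: eq_bigr => a _.
by rewrite rmorphM !mxE.
Qed.

Variable K : numFieldType.

Definition nf_tuple t r (c : 'I_#|{: 'I_n * 'I_n}| * {ffun 'I_n -> 'I_t + 'I_r}) :
    (sv_N m).+1.-tuple {mpoly K[#|nf_param t r|]} :=
  [tuple slice_entry (nf_slices c.1 c.2 (fun z => 'X_(enum_rank z))) l | l < (sv_N m).+1].

Lemma meval_nf_tuple t r c F (w : nf_param t r -> K) :
  F \mPo nf_tuple c = 0 -> F.@[slice_entry (nf_slices c.1 c.2 w)] = 0.
Proof.
move=> F0; pose u (i : 'I_#|nf_param t r|) := w (enum_val i).
rewrite -[RHS](meval0 u) -F0 comp_mpoly_meval.
apply: meval_eq => l; rewrite tnth_mktuple (slice_entry_map (meval u)).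
apply: eq_slice_entry => i; rewrite map_nf_slices; congr nf_slices.
by apply: funext => z /=; rewrite mevalXU /u enum_rankK.
Qed.

Lemma power_slices_nf t r (X : 'M[K]_(t + n, 2)) (Y Z : 'M[K]_(t + n, n)) :
    (n = t + r)%N -> power_slices X Y Z 0 \in unitmx ->
  exists q (sigma : {ffun 'I_n -> 'I_t + 'I_r}) a w,
    forall i, power_slices X Y Z i = a *: nf_slices q sigma w i.
Proof.
set A := power_slices X Y Z => ntr A0u.
have i2 (i : 'I_3) : i = 0 \/ i = 1 \/ i = 2%:R.
  by case: i => [[|[|[|i]]] lt] //; [left|right; left|right; right]; apply/val_inj.
pose B := invmx (A 0) *m A 1; pose S := invmx (A 0) *m A 2%:R - B *m B.
have rkS : (\rank S <= t)%N.
  have A1E := power_slicesE X Y Z (i := 1) (c := 1) (c' := 0) erefl.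
  have A1E' := power_slicesE X Y Z (i := 1) (c := 0) (c' := 1) erefl.
  have A0E := power_slicesE X Y Z (i := 0) (c := 0) (c' := 0) erefl.
  have A2E := power_slicesE X Y Z (i := 2%:R) (c := 1) (c' := 1) erefl.
  have -> : S = invmx (A 0) *m (A 2%:R - A 1 *m invmx (A 0) *m A 1).
    by rewrite /S /B mulmxBr !mulmxA.
  apply: leq_trans (mxrankM_maxr _ _) _.
  move: A0u; rewrite /A {1}A1E A1E' A0E A2E => A0u.
  by apply: leq_trans (rank_schur_complement _ _ A0u) _; rewrite addnK.
have [sigma [S1 [W SE]]] := rank_row_pattern ntr rkS.
(* A nonzero entry of [A 0] is scaled to 1; its position becomes [q] and its value the factor [a],
   which saves one parameter. *)
have /matrix0Pn[j [k ajk]] : A 0 != 0.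
  by apply: contraTneq A0u => ->; rewrite unitmxE det0 unitr0.
pose a := A 0 j k.
have [|w wE] := @nf_slices_surj K t r (enum_rank (j, k)) sigma (a^-1 *: A 0) B S S1 W _ SE.
  by rewrite enum_rankK mxE mulVf.
exists (enum_rank (j, k)), sigma, a, w => i; rewrite wE -mulmxE -scalemxAl scalerA mulfV //.
rewrite scale1r mulmxDr; case: (i2 i) => [|[|]] -> /=.
- by rewrite expr0 mulmx1 mulr0n mulmx0 addr0.
- by rewrite expr1 mulr0n mulmx0 addr0 mulKVmx.
- by rewrite mulr1n expr2 -mulmxE -mulmxDr [_ + S]addrC subrK mulKVmx.
Qed.

(** Along a segment of parameters, [F] is a polynomial in [u] that vanishes wherever the determinant
    of the first slice does not; this determinant is nonzero at [u = 1]. *)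
Lemma vanishes_on_power_slices t r E (F : {mpoly K[(sv_N m).+1]}) :
    (n = t + r)%N -> F \is E.-homog ->
    (forall c, F \mPo @nf_tuple t r c = 0) ->
  forall (X : 'M[K]_(t + n, 2)) (Y Z : 'M[K]_(t + n, n)),
    F.@[slice_entry (power_slices X Y Z)] = 0.
Proof.
move=> ntr hF F0 X Y Z.
(* At the endpoint, x is (1,0) for all points, and y and z are the p-th basis vector for [p < n] and
   0 for the other [t] points; the first slice is then the identity. *)
pose P0 d : 'M[K]_(t + n, d) := \matrix_(p, j) (p == j :> nat)%:R.
pose X0 : 'M[K]_(t + n, 2) := \matrix_(p, c) (c == 0)%:R.
pose seg d (M M0 : 'M[K]_(t + n, d)) u := M + u *: (M0 - M).
pose A u := power_slices (seg _ X X0 u) (seg _ Y (P0 n) u) (seg _ Z (P0 n) u).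
have segP d (M M0 : 'M[K]_(t + n, d)) p j : polyfun (fun u => seg d M M0 u p j).
  have -> : (fun u => seg d M M0 u p j) = (fun u => M p j + u * (M0 p j - M p j)).
    by apply: funext => u; rewrite !mxE.
  apply: polyfunD; first exact: polyfun_cst.
  by apply: polyfunM; [apply: polyfun_id|apply: polyfun_cst].
have AP i j k : polyfun (fun u => A u i j k).
  have -> : (fun u => A u i j k) = (fun u => \sum_(p < t + n) seg _ X X0 u p 0 ^+ (2 - i)
      * seg _ X X0 u p 1 ^+ i * seg _ Y (P0 n) u p j * seg _ Z (P0 n) u p k).
    by apply: funext => u; rewrite mxE.
  by apply: polyfun_sum => p; do !apply: polyfunM; try apply: polyfunX; apply: segP.
suff /(_ 0) : forall u, F.@[slice_entry (A u)] = 0.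
  by rewrite /A /seg !scale0r !addr0.
apply: (@polyfun_density _ _ (fun u => \det (A u 0)) 1).
- apply: polyfun_meval => l; rewrite /slice_entry.
  by case: enum_val => [[i j] k]; apply: AP.
- by apply: polyfun_det => j k; apply: AP.
- rewrite (_ : A 1 0 = 1%:M) ?det1 ?oner_neq0 //; apply/matrixP => j k.
  have seg1 d (M M0 : 'M[K]_(t + n, d)) : seg d M M0 1 = M0.
    by rewrite /seg scale1r addrC subrK.
  rewrite /A !seg1 !mxE.
  rewrite (bigD1 (widen_ord (leq_addl t n) j)) //= big1 => [|p pj].
    by rewrite !mxE /= expr1n expr0 !mul1r eqxx mul1r addr0.
  by rewrite !mxE -(inj_eq val_inj) /= in pj *; rewrite (negPf pj) mulr0 mul0r.
- move=> u Au; have [|q [sigma [a [w Aw]]]] := power_slices_nf ntr _ (X := seg _ X X0 u)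
    (Y := seg _ Y (P0 n) u) (Z := seg _ Z (P0 n) u).
    by rewrite unitmxE unitfE.
  rewrite (meval_eq (v2 := fun l => a * slice_entry (nf_slices q sigma w) l)).
    by rewrite (meval_homogZ a _ hF) (meval_nf_tuple (c := (q, sigma))) ?mulr0.
  move=> l; rewrite /A /slice_entry; case: enum_val => [[i j] k].
  by rewrite Aw mxE.
Qed.

End Slices.

(** * Spans of points of the Segre-Veronese variety *)

Section Secant.
Variables (K : fieldType) (m : nat).
Notation n := m.+1.

Lemma scale_sv_vector (k : K) x (y z : 'rV_n) : k *: sv_vector x y z = sv_vector x (k *: y) z.
Proof.
apply/rowP => l; rewrite !mxE; case: enum_val => [[i j] c] /=.
by rewrite !mxE mulrA [k * _]mulrCA.
Qed.

(** The coefficients of a linear combination are absorbed into the y-vectors. *)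
Lemma mem_span_segre_veronese s (p : 'I_s -> proj_space K (sv_N m)) v :
  (forall i, segre_veronese K m (p i)) -> v \in (\sum_(i < s) val (p i))%VS ->
  exists (X : 'M[K]_(s, 2)) (Y Z : 'M[K]_(s, n)), v = \row_l slice_entry (power_slices X Y Z) l.
Proof.
move=> hp /memv_sumP[w wp ->].
have {hp wp} /choice[f fE] : forall i, exists f : 'rV[K]_2 * 'rV[K]_n * 'rV[K]_n,
    w i = sv_vector f.1.1 f.1.2 f.2.
  move=> i; have [x [y [z [_ _ _ pE]]]] := hp i.
  have := wp i isT; rewrite pE => /vlineP[k ->].
  by exists (x, k *: y, z); rewrite scale_sv_vector.
exists (\matrix_i (f i).1.1), (\matrix_i (f i).1.2), (\matrix_i (f i).2).
by rewrite -sum_sv_vector; apply: eq_bigr => i _; rewrite fE !rowK.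
Qed.

Lemma sv_vector_delta (j k : 'I_n) :
  sv_vector (delta_mx 0 0) (delta_mx 0 j) (delta_mx 0 k)
    = delta_mx 0 (cast_ord (card_sv_index m) (enum_rank (0, j, k))) :> 'rV[K]__.
Proof.
apply/rowP => l; rewrite !mxE eqxx /=.
have -> : (l == cast_ord (card_sv_index m) (enum_rank (0, j, k)))
    = (enum_val (cast_ord (esym (card_sv_index m)) l) == (0, j, k)).
  rewrite -(inj_eq (@enum_rank_inj _)) enum_valK -(inj_eq (@cast_ord_inj _ _ (card_sv_index m))).
  by rewrite cast_ordKV.
case: enum_val => [[i j'] k']; rewrite /= !mxE !eqxx /= !xpair_eqE expr1n mul1r.
have -> : (0 : K) ^+ i = (i == 0)%:R by rewrite expr0n.
by rewrite -!mulnb !natrM.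
Qed.

(** With x = (1,0) and basis vectors for y and z, the variety contains [n * n] distinct coordinate
    points; any [s] of them are independent. *)
Lemma secant_nonempty s : (0 < s <= n * n)%N ->
  (secant_variety s (segre_veronese K m) !=set0)%classic.
Proof.
move=> /andP[s0 sn].
have sn' : (s <= #|{: 'I_n * 'I_n}|)%N by rewrite card_prod card_ord.
pose g (i : 'I_s) : 'I_n * 'I_n := enum_val (widen_ord sn' i).
pose c i := cast_ord (card_sv_index m) (enum_rank (0, (g i).1, (g i).2)).
have cinj : injective c.
  move=> i i' /cast_ord_inj /enum_rank_inj [] g1 g2; apply/val_inj.
  suff /enum_val_inj /(congr1 val) : g i = g i' by [].
  by case: (g i) (g i') g1 g2 => [? ?] [? ?] /= -> ->.
pose L i : {vspace 'rV[K]_(sv_N m).+1} := <[(delta_mx 0 (c i))%R]>%VS.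
have d0 d (i : 'I_d) : delta_mx 0 i != 0 :> 'rV[K]_d.
  by apply/rV0Pn; exists i; rewrite mxE !eqxx oner_neq0.
have dimL i : \dim (L i) == 1%N by rewrite dim_vline d0.
pose p i : proj_space K (sv_N m) := exist _ (L i) (dimL i).
exists (p (Ordinal s0)) => Y _; apply; exists p; split.
- move=> i; exists (delta_mx 0 0), (delta_mx 0 (g i).1), (delta_mx 0 (g i).2).
  by rewrite !d0 sv_vector_delta.
- rewrite /independent_points /=.
  pose X := [tuple delta_mx 0 (c i) : 'rV[K]_(sv_N m).+1 | i < s].
  have -> : (\sum_(i < s) L i = <<X>>)%VS.
    by rewrite span_def big_tuple; apply: eq_bigr => i _; rewrite tnth_mktuple.
  suff /eqP -> : free X by rewrite size_tuple.
  have XE (i : 'I_s) : X`_i = delta_mx 0 (c i) by rewrite -tnth_nth tnth_mktuple.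
  apply/freeP => k kX i; have /rowP/(_ (c i)) := kX.
  rewrite summxE mxE (bigD1 i) // big1 => [|i' i'i].
    by rewrite XE !mxE !eqxx /= mulr1 addr0.
  by rewrite XE !mxE (inj_eq cinj) eq_sym (negPf i'i) mulr0.
- exact: (sumv_sup (Ordinal s0)).
Qed.

End Secant.

(** * Parameter count and defectivity *)

(** The count falls short of the two terms of the minimum by [r ^ 2] and [t ^ 2] respectively. *)
Lemma nf_param_lt_expected m t r : (0 < t)%N -> (0 < r)%N -> (m.+1 = t + r)%N ->
  (#|nf_param m t r| < expected_dim (sv_N m) (1 + m + m) (t + m.+1))%N.
Proof.
move=> t0 r0 mtr; rewrite !card_sum !card_prod !card_ord /expected_dim /sv_N expnS expn1 leq_min.
rewrite -[(1 + m + m)%N]/(m.+1 + m)%N.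
apply/andP; split; nia.
Qed.

Local Close Scope ring_scope.

Theorem corollary5p5 (R : realType) (m s : nat) :
  1 <= m ->
  m + 2 <= s -> s <= 2 * m + 1 ->
  defective (1 + m + m) s (segre_veronese R[i]%C m).
Proof.
move=> m1 ms sm.
(* [t] bounds the rank of the Schur complement. The bounds on [s] amount to [t > 0] and
   [r = 2 * m + 2 - s > 0]. *)
pose t := (s - m.+1)%N; pose r := (m.+1 - t)%N.
have ntr : (m.+1 = t + r)%N by rewrite /r /t; lia.
have st : s = (t + m.+1)%N by rewrite /t; lia.
have t0 : (0 < t)%N by rewrite /t; lia.
have r0 : (0 < r)%N by rewrite /r /t; lia.
have lt := nf_param_lt_expected t0 r0 ntr; rewrite -st in lt.
have [|e|d hd dle] := @has_dim_of_chain_bound _ _ (secant_variety s (segre_veronese R[i]%C m))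
    #|nf_param m t r|.
- by apply: secant_nonempty; nia.
- apply: (chain_length_le (Phi := @nf_tuple m _ t r)) => F E hF F0 q [p [Xp _ pq]] v qv.
  have [X [Y [Z ->]]] := mem_span_segre_veronese Xp (subvP pq _ qv).
  move: X Y Z; rewrite st => X Y Z; rewrite -[RHS](vanishes_on_power_slices ntr hF F0 X Y Z).
  by apply: meval_eq => l; rewrite mxE.
exists d; split => // dE; rewrite dE in dle.
by move: lt; rewrite ltnNge dle.
Qed.
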